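(* Let $H, B \in M_n$ be Hermitian matrices with $B$ positive semidefinite. Let $P^+$ and $P^-$ denote the orthogonal projections onto the strictly positive and strictly negative eigenspaces of $H$, respectively. Then $H$ is Birkhoff--James orthogonal to $B$ in the trace norm if and only if both $$\operatorname{Tr}(BP^+) \le \tfrac{1}{2}\operatorname{Tr}(B) \quad\text{and}\quad \operatorname{Tr}(BP^-) \le \tfrac12 \operatorname{Tr}(B).$$
   Context: $M_n$ is the set of $n\times n$ complex matrices. The trace norm $\|A\|_{\mathrm{tr}}$ is the sum of the singular values of $A$. For Hermitian $A,B\in M_n$, $A$ is Birkhoff--James orthogonal to $B$ (in the trace norm) if $\|A\|_{\mathrm{tr}} \le \|A+\lambda B\|_{\mathrm{tr}}$ for all $\lambda\in\mathbb{R}$. The ''strictly positive (resp. negative) eigenspace'' of a Hermitian matrix means the direct sum of all its eigenspaces corresponding to strictly positive (resp. negative) eigenvalues. *)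

(* Defs.v *)
From mathcomp Require Import all_boot all_order all_algebra.
From mathcomp Require Import complex.
From mathcomp Require Import reals.

Set Implicit Arguments.
Unset Strict Implicit.
Unset Printing Implicit Defensive.

Import Order.TTheory GRing.Theory Num.Theory.
Local Open Scope ring_scope.
Local Open Scope sesquilinear_scope.
Local Open Scope complex_scope.

(* In a numClosedFieldType, [x <= y] says that [y - x] is a nonnegative real;
   on real values, such as the norms and traces compared here, it is the usual
   order of the reals. *)

Section Eigen.
Variable C : numClosedFieldType.

(* Listed with algebraic multiplicity, in no particular order. *)
Definition eigvals n (A : 'M[C]_n) : seq C :=
  sval (closed_field_poly_normal (char_poly A)).

Definition singvals n (A : 'M[C]_n) : seq C :=
  [seq sqrtC a | a <- eigvals (A^t* *m A)].

Definition trnorm n (A : 'M[C]_n) : C := \sum_(s <- singvals A) s.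

Definition psdmx n (B : 'M[C]_n) : Prop :=
  forall v : 'cV[C]_n, 0 <= (v^t* *m B *m v) 0 0.

(* Subspaces are row spaces, and [eigenspace] is made of row eigenvectors. For
   a Hermitian A, u is a row eigenvector iff u^t* is a column eigenvector for
   the same (real) eigenvalue. The matrix [proj_ortho U] is Hermitian, so for
   the spaces below it is also the matrix of the orthogonal projection onto the
   corresponding spaces of column vectors. Each eigenvalue occurs once in
   [undup (eigvals A)], so the sums are direct. *)
Definition pos_eigenspace n (A : 'M[C]_n) : 'M[C]_n :=
  (\sum_(a <- undup (eigvals A) | (0 < a)%R) eigenspace A a)%MS.

Definition neg_eigenspace n (A : 'M[C]_n) : 'M[C]_n :=
  (\sum_(a <- undup (eigvals A) | (a < 0)%R) eigenspace A a)%MS.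

Definition pos_proj n (A : 'M[C]_n) : 'M[C]_n := proj_ortho (pos_eigenspace A).

Definition neg_proj n (A : 'M[C]_n) : 'M[C]_n := proj_ortho (neg_eigenspace A).

End Eigen.

Definition trnorm_BJ_orthogonal (R : realType) n (A B : 'M[R[i]]_n) : Prop :=
  forall l : R, trnorm A <= trnorm (A + l%:C *: B).

(* Main.v *)
Require Import Defs.
From mathcomp Require Import all_boot all_order all_algebra.
From mathcomp Require Import complex.
From mathcomp Require Import reals.
From mathcomp Require Import ring.

Set Implicit Arguments.
Unset Strict Implicit.
Unset Printing Implicit Defensive.

Import Order.TTheory GRing.Theory Num.Theory.
Local Open Scope ring_scope.
Local Open Scope complex_scope.
Local Open Scope sesquilinear_scope.

(* Write H^+ for the positive part of H and P0 for the projection onto its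
   kernel. For Hermitian A the trace norm satisfies
     Tr(W A) <= ||A||          whenever -1 <= W <= 1,
     ||A|| <= 2 Tr X - Tr A    whenever X >= 0 and X >= A.
   Given the two trace inequalities, some c in [-1, 1] makes
   W = P^+ - P^- + c P0 satisfy Tr(W B) = 0, so that
   ||H|| = Tr(W H) = Tr(W (H + l B)) <= ||H + l B||.
   Conversely, the second bound applied to H - e B, with an X >= 0 of trace
   Tr H^+ - e Tr(B P^+) + O(e^2), gives
     ||H - e B|| <= ||H|| - e (2 Tr(B P^+) - Tr B) + O(e^2),
   whence the bound on Tr(B P^+) as e -> 0; the one on Tr(B P^-) follows by
   replacing H with -H. *)

Section UnitaryDiagonal.
Variables (C : numClosedFieldType) (n : nat).
Implicit Types (A B M S T W X : 'M[C]_n) (w z d : 'I_n -> C).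

(** * Adjoints, and matrices that are diagonal in a unitary basis *)

Lemma trmxC_mul m p q (A : 'M[C]_(m, p)) (B : 'M[C]_(p, q)) :
  (A *m B)^t* = B^t* *m A^t*.
Proof. by rewrite trmx_mul map_mxM. Qed.

Lemma trmxCD m p (A B : 'M[C]_(m, p)) : (A + B)^t* = A^t* + B^t*.
Proof. by rewrite linearD /= map_mxD. Qed.

Lemma trmxCB m p (A B : 'M[C]_(m, p)) : (A - B)^t* = A^t* - B^t*.
Proof. by rewrite linearB /= map_mxB. Qed.

Lemma trmxCZ m p c (A : 'M[C]_(m, p)) : (c *: A)^t* = c^* *: A^t*.
Proof. by rewrite linearZ /= map_mxZ. Qed.

(** For unitary [S], row [i] of [S] is a row eigenvector with eigenvalue [w i]. With [S] fixed this
    is a functional calculus: sums, products and traces are computed on the weights. *)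
Definition udiag S w : 'M[C]_n := S^t* *m diag_mx (\row_j w j) *m S.

Lemma eq_udiag S w z : w =1 z -> udiag S w = udiag S z.
Proof.
move=> e; rewrite /udiag; congr (_ *m diag_mx _ *m _).
by apply/rowP=> j; rewrite !mxE.
Qed.

Lemma udiagD S w z : udiag S w + udiag S z = udiag S (fun i => w i + z i).
Proof.
rewrite /udiag -mulmxDl -mulmxDr -linearD /=.
by congr (_ *m diag_mx _ *m _); apply/rowP=> j; rewrite !mxE.
Qed.

Lemma udiagZ S c w : c *: udiag S w = udiag S (fun i => c * w i).
Proof.
rewrite /udiag scalemxAl scalemxAr -linearZ /=.
by congr (_ *m diag_mx _ *m _); apply/rowP=> j; rewrite !mxE.
Qed.

Lemma udiagN S w : - udiag S w = udiag S (fun i => - w i).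
Proof. by rewrite -scaleN1r udiagZ; apply: eq_udiag => i; rewrite mulN1r. Qed.

Lemma udiag1 S : S \is unitarymx -> udiag S (fun=> 1) = 1%:M.
Proof.
move=> uS; rewrite /udiag -[S^t*]invmx_unitary //.
rewrite (_ : diag_mx _ = 1%:M) ?mulmx1 ?mulVmx ?unitarymx_unit //.
by apply/matrixP=> i j; rewrite !mxE.
Qed.

Lemma udiagM S w z : S \is unitarymx ->
  udiag S w *m udiag S z = udiag S (fun i => w i * z i).
Proof.
move=> /unitarymxP uS; rewrite /udiag !mulmxA -[_ *m S *m _]mulmxA uS mulmx1.
rewrite -[_ *m diag_mx _ *m diag_mx _]mulmxA mulmx_diag.
by congr (_ *m diag_mx _ *m _); apply/rowP=> j; rewrite !mxE.
Qed.

Lemma udiag_trmxC S w : (forall i, w i \is Num.real) ->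
  (udiag S w)^t* = udiag S w.
Proof.
move=> wR; rewrite /udiag !trmxC_mul trmxCK mulmxA tr_diag_mx map_diag_mx.
congr (_ *m diag_mx _ *m _); apply/rowP=> j; rewrite !mxE.
exact/CrealP.
Qed.

Lemma mxtrace_mul_udiag S w M :
  \tr (M *m udiag S w) = \sum_i w i * (S *m M *m S^t*) i i.
Proof.
rewrite /udiag !mulmxA mxtrace_mulC !mulmxA mul_mx_diag.
by apply: eq_bigr => i _; rewrite !mxE mulrC.
Qed.

Lemma mxtrace_udiag S w : S \is unitarymx -> \tr (udiag S w) = \sum_i w i.
Proof.
move=> uS; rewrite -[udiag S w]mul1mx mxtrace_mul_udiag mulmx1.
by rewrite (unitarymxP uS); apply: eq_bigr => i _; rewrite mxE eqxx mulr1.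
Qed.

Lemma char_poly_udiag S w : S \is unitarymx ->
  char_poly (udiag S w) = \prod_i ('X - (w i)%:P).
Proof.
move=> uS; have /mulmx1C uS' := unitarymxP uS.
transitivity (char_poly (diag_mx (\row_j w j))); last first.
  rewrite char_poly_trig ?diag_mx_is_trig //.
  by apply: eq_bigr => i _; rewrite !mxE eqxx.
pose Sp := map_mx polyC S; pose Sq := map_mx polyC (S^t*).
have e1 : Sq *m Sp = 1%:M by rewrite -map_mxM uS' map_mx1.
rewrite /char_poly.
have -> : char_poly_mx (udiag S w) =
    Sq *m char_poly_mx (diag_mx (\row_j w j)) *m Sp.
  rewrite /char_poly_mx mulmxBr mulmxBl mul_mx_scalar -scalemxAl e1 scalemx1.
  by rewrite /udiag !map_mxM.
by rewrite !det_mulmx mulrC mulrA -det_mulmx (mulmx1C e1) det1 mul1r.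
Qed.

Lemma perm_eigvals_udiag S w : S \is unitarymx ->
  perm_eq (eigvals (udiag S w)) [seq w i | i <- enum 'I_n].
Proof.
move=> uS; rewrite /eigvals; case: closed_field_poly_normal => s /=.
rewrite (monicP (char_poly_monic _)) scale1r char_poly_udiag // => e.
by apply: prod_XsubC_eq; rewrite -e big_map big_enum.
Qed.

(** The matrix is its own adjoint, so its singular values are the square roots of the squares of the
    real weights. *)
Lemma trnorm_udiag S w : S \is unitarymx -> (forall i, w i \is Num.real) ->
  trnorm (udiag S w) = \sum_i `|w i|.
Proof.
move=> uS wR; rewrite /trnorm /singvals udiag_trmxC // udiagM // big_map.
rewrite (perm_big _ (perm_eigvals_udiag _ uS)) /= big_map big_enum /=.
apply: eq_bigr => i _.
by rewrite normC_def (CrealP (wR i)).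
Qed.

(** * Spectral decomposition and spectral projections *)

Lemma hermsymmx_udiag A : A \is hermsymmx ->
  exists S d,
    [/\ S \is unitarymx, (forall i, d i \is Num.real) & A = udiag S d].
Proof.
move=> hA; exists (spectralmx A), (fun i => spectral_diag A 0 i); split.
- exact: spectral_unitarymx.
- by move=> i; have /mxOverP := hermitian_spectral_diag_real hA; apply.
rewrite /udiag -invmx_unitary ?spectral_unitarymx //.
rewrite [LHS](orthomx_spectralP (hermitian_normalmx hA)).
by congr (_ *m diag_mx _ *m _); apply/rowP=> j; rewrite !mxE.
Qed.

(** The rows of [P] lie in [U] and those of [1 - P] are orthogonal to [U], so the projection fixes
    [P] and kills [1 - P]; applied to their sum, the identity, it gives [P]. *)
Lemma proj_ortho_udiag S d (p : pred C) : S \is unitarymx ->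
  proj_ortho (\sum_(a <- undup (eigvals (udiag S d)) | p a)
    eigenspace (udiag S d) a)%MS = udiag S (fun i => (p (d i))%:R).
Proof.
move=> uS; set U := (\sum_(a <- _ | _) _)%MS; set P := udiag _ _.
have SSt := unitarymxP uS; have StS := mulmx1C SSt.
have PU : (P <= U)%MS.
  rewrite /P /udiag -mulmxA mulmx_sub //; apply/row_subP => i.
  rewrite mul_diag_mx; set r := row i _.
  have -> : r = (p (d i))%:R *: row i S by apply/rowP=> j; rewrite !mxE.
  case pdi: (p (d i)); last by rewrite scale0r sub0mx.
  rewrite scale1r /U big_mkcond (bigD1_seq (d i)) ?undup_uniq //=; last first.
    rewrite mem_undup (perm_mem (perm_eigvals_udiag d uS)).
    by apply: map_f; rewrite mem_enum.
  rewrite pdi /=.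
  apply: submx_trans (addsmxSl _ _); apply/eigenspaceP.
  rewrite /udiag !mulmxA -row_mul SSt -row_mul mul1mx.
  by rewrite row_diag_mx mxE -scalemxAl -rowE.
have PU' : (1%:M - P <=
    orthomx Num.conj (mx_of_hermitian (hermitian1mx n)) U)%MS.
  rewrite orthomx_sym /U.
  have PC : (1%:M - P)^t* = udiag S (fun i => (~~ p (d i))%:R).
    rewrite -(udiag1 uS) udiagN udiagD udiag_trmxC.
      apply: eq_udiag => i.
      by case: (p _); rewrite ?subrr ?subr0.
    by move=> i; rewrite rpredB ?rpred1 ?rpred_nat.
  elim/big_ind: _ => [|V1 V2|a pa]; first exact: sub0mx.
    by move=> h1 h2; rewrite addsmx_sub h1.
  set E := eigenspace _ a; have /eigenspaceP : (E <= E)%MS by [].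
  rewrite orthomx1E PC.
  rewrite /udiag !mulmxA; set F := E *m S^t* => FE.
  have : F *m diag_mx (\row_j d j) = a *: F.
    move: (congr1 (mulmx^~ (S^t*)) FE); rewrite -!mulmxA SSt mulmx1 => ->.
    by rewrite -scalemxAl.
  (* [F] holds the coordinates of the eigenvectors in the basis of rows of [S]. Column [j] vanishes
     unless [d j = a], and then [p (d j)] holds and the weight of [1 - P] is zero. *)
  rewrite !mul_mx_diag => /matrixP Fd; apply/eqP.
  rewrite (_ : \matrix_(i, j) _ = 0) ?mul0mx //; apply/matrixP=> i j.
  rewrite !mxE; move: (Fd i j); rewrite !mxE.
  case pdj: (p (d j)); rewrite ?mulr0 // mulr1 mulrC => /eqP.
  rewrite -subr_eq0 -mulrBl mulf_eq0 subr_eq0 => /orP[/eqP e|/eqP //].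
  by move: pdj; rewrite e pa.
rewrite -[LHS]mul1mx -[in LHS](subrK P 1%:M) mulmxDl.
by rewrite proj_ortho_0 // proj_ortho_id // add0r.
Qed.

Lemma pos_proj_udiag S d : S \is unitarymx ->
  pos_proj (udiag S d) = udiag S (fun i => (0 < d i)%R%:R).
Proof. exact: (@proj_ortho_udiag S d (fun a => 0 < a)). Qed.

Lemma neg_proj_udiag S d : S \is unitarymx ->
  neg_proj (udiag S d) = udiag S (fun i => (d i < 0)%R%:R).
Proof. exact: (@proj_ortho_udiag S d (fun a => a < 0)). Qed.

Lemma neg_proj_opp S d : S \is unitarymx ->
  neg_proj (udiag S d) = pos_proj (udiag S (fun i => - d i)).
Proof.
move=> uS; rewrite neg_proj_udiag // pos_proj_udiag //.
by apply: eq_udiag => i; rewrite oppr_gt0.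
Qed.

(** * Positive semidefinite matrices *)

Lemma psdmxD A B : psdmx A -> psdmx B -> psdmx (A + B).
Proof. by move=> hA hB v; rewrite mulmxDr mulmxDl mxE addr_ge0. Qed.

Lemma psdmxZ c A : 0 <= c -> psdmx A -> psdmx (c *: A).
Proof. by move=> hc hA v; rewrite -scalemxAr -scalemxAl mxE mulr_ge0. Qed.

Lemma psdmx_congr T A : psdmx A -> psdmx (T^t* *m A *m T).
Proof.
move=> hA v; have := hA (T *m v).
by rewrite trmxC_mul !mulmxA.
Qed.

Lemma psdmx_udiag S w : (forall i, 0 <= w i) -> psdmx (udiag S w).
Proof.
move=> hw; apply: psdmx_congr => v.
rewrite mul_mx_diag mxE; apply: sumr_ge0 => i _; rewrite !mxE.
by rewrite mulrAC mulr_ge0 // mulrC mul_conjC_ge0.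
Qed.

(** The entry is the quadratic form of [A] at the adjoint of row [i] of [S]. *)
Lemma psdmx_diag_ge0 S A i : psdmx A -> 0 <= (S *m A *m S^t*) i i.
Proof.
move=> /(_ ((row i S)^t*)); rewrite trmxCK -row_mul.
set x := (_ *m _) 0 0; set y := (_ *m _) i i.
suff -> : x = y by [].
by rewrite /x /y !mxE; apply: eq_bigr => k _; rewrite !mxE.
Qed.

Lemma psdmx_tr_ge0 A : psdmx A -> 0 <= \tr A.
Proof.
move=> /(psdmx_diag_ge0 1%:M) h; apply: sumr_ge0 => i _.
by have := h i; rewrite mul1mx trmx1 map_mx1 mulmx1.
Qed.

(** * Variational bounds on the trace norm *)

(** In an eigenbasis of [A] the trace is the sum of the [d i * x], where the diagonal entry [x] of
    [W] lies in [-1, 1]. *)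
Lemma mxtrace_le_trnorm A W : A \is hermsymmx ->
  psdmx (1%:M - W) -> psdmx (1%:M + W) -> \tr (W *m A) <= trnorm A.
Proof.
move=> /hermsymmx_udiag[S [d [uS dR ->]]] h1 h2.
rewrite trnorm_udiag // mxtrace_mul_udiag; apply: ler_sum => i _.
have := psdmx_diag_ge0 S i h1; have := psdmx_diag_ge0 S i h2.
rewrite mulmxBr mulmxDr mulmxBl mulmxDl mulmx1 (unitarymxP uS) !mxE eqxx.
set x : C := \sum_j _ => x1 x2.
(* Only reals are comparable with 0, so [0 <= 1 + x] makes [x] real. *)
have xR : x \is Num.real.
  by rewrite -[x](addKr 1) addrC rpredB ?ger0_real.
apply: (le_trans (real_ler_norm _)); first by rewrite rpredM.
rewrite normrM ler_piMr // real_ler_norml //.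
by rewrite -[x <= 1]subr_ge0 x2 -[-1 <= x]subr_ge0 opprK addrC x1.
Qed.

(** In an eigenbasis of [A], each diagonal entry [x] of [X] is at least 0 and at least [d i], whence
    [|d i| <= 2 x - d i]. *)
Lemma trnorm_le_mxtrace A X : A \is hermsymmx ->
  psdmx X -> psdmx (X - A) -> trnorm A <= 2 * \tr X - \tr A.
Proof.
move=> /hermsymmx_udiag[S [d [uS dR ->]]] h1 h2.
rewrite trnorm_udiag // mxtrace_udiag // -[X]mulmx1 -(udiag1 uS).
rewrite mxtrace_mul_udiag mulr_sumr -sumrB; apply: ler_sum => i _.
have := psdmx_diag_ge0 S i h1; have := psdmx_diag_ge0 S i h2.
rewrite mulmxBr mulmxBl /udiag !mulmxA (unitarymxP uS) mul1mx -!mulmxA.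
rewrite (unitarymxP uS) mulmx1 !mulmxA !mxE eqxx mulr1n mul1r subr_ge0.
set x : C := \sum_j _ => x1 x2.
case: (real_ge0P (dR i)) => di.
  by rewrite lerBrDr -mulr2n -[_ *+ 2]mulr_natl ler_pM2l.
by rewrite lerBrDr addNr mulr_ge0.
Qed.

Lemma hermsymmxP A : reflect (A^t* = A) (A \is hermsymmx).
Proof.
rewrite is_hermitianmxE expr0 scale1r eq_sym; exact: eqP.
Qed.

Lemma hermsymmxDZ A B l : A \is hermsymmx -> B \is hermsymmx ->
  l \is Num.real -> A + l *: B \is hermsymmx.
Proof.
move=> /hermsymmxP hA /hermsymmxP hB /CrealP lR; apply/hermsymmxP.
by rewrite trmxCD trmxCZ hA hB lR.
Qed.

Lemma hermsymmx_udiag_real S w : (forall i, w i \is Num.real) ->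
  udiag S w \is hermsymmx.
Proof. by move=> wR; apply/hermsymmxP/udiag_trmxC. Qed.

Lemma trnormN A : trnorm (- A) = trnorm A.
Proof.
rewrite /trnorm /singvals -[X in X^t*]sub0r trmxCB trmx0 map_mx0 sub0r.
by rewrite mulNmx mulmxN opprK.
Qed.

(** * The trace inequalities imply orthogonality *)

Lemma trnorm_le_of_tr_proj S d B l : S \is unitarymx ->
    (forall i, d i \is Num.real) -> B \is hermsymmx -> psdmx B ->
    \tr (B *m pos_proj (udiag S d)) <= 2^-1 * \tr B ->
    \tr (B *m neg_proj (udiag S d)) <= 2^-1 * \tr B ->
    l \is Num.real ->
  trnorm (udiag S d) <= trnorm (udiag S d + l *: B).
Proof.
move=> uS dR hB B0 + + lR.
rewrite pos_proj_udiag // neg_proj_udiag //.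
pose P0 := udiag S (fun i => (d i == 0)%:R).
set p := \tr _; set m := \tr (B *m udiag S (fun i => (d i < 0)%R%:R)).
pose z := \tr (B *m P0).
have tr_ge0 (q : 'I_n -> bool) : 0 <= \tr (B *m udiag S (fun i => (q i)%:R)).
  rewrite mxtrace_mul_udiag sumr_ge0 // => i _.
  by rewrite mulr_ge0 ?ler0n ?psdmx_diag_ge0.
have z0 : 0 <= z := tr_ge0 (fun i => d i == 0).
have -> : \tr B = p + m + z.
  rewrite /p /m /z -!mxtraceD -!mulmxDr /P0 !udiagD -[in LHS](mulmx1 B).
  rewrite -(udiag1 uS); congr (\tr (_ *m _)); apply: eq_udiag => i.
  by case: (real_ltgt0P (dR i)); rewrite ?addr0 ?add0r.
rewrite !(mulrC 2^-1) !ler_pdivlMr ?ltr0n // !mulr_natr !mulr2n.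
move=> hp hm.
have pmz : p <= m + z by rewrite -(lerD2l p) addrA.
have mpz : m <= p + z by rewrite -(lerD2l m) addrA [m + p]addrC.
(* The two inequalities put [(m - p) / z] in [-1, 1]; if [z = 0] they force [p = m], and [c = 0]
   will do. *)
have [c [c1 c2 cE]] : exists c, [/\ -1 <= c, c <= 1 & p - m + c * z = 0].
  have [zE|zN0] := eqVneq z 0.
    exists 0; rewrite lerN10 ler01 zE mulr0 addr0; split=> //.
    rewrite zE !addr0 in pmz mpz.
    by apply/eqP; rewrite subr_eq0 eq_le pmz mpz.
  have zgt : 0 < z by rewrite lt_def zN0.
  exists ((m - p) / z); split.
  - by rewrite ler_pdivlMr // mulN1r lerBrDr addrC lerBlDr.
  - by rewrite ler_pdivrMr // mul1r lerBlDr addrC.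
  - by rewrite divfK // addrC subrKA subrr.
pose w i := (0 < d i)%R%:R + (- (d i < 0)%R%:R + c * (d i == 0)%:R).
have w1 i : -1 <= w i /\ w i <= 1.
  rewrite /w; case: (real_ltgt0P (dR i)) => _;
  rewrite /= ?mulr1n ?mulr0n ?mulr0 ?mulr1 ?oppr0 ?addr0 ?add0r ?lexx //;
  by rewrite (le_trans (lerN10 _) ler01).
have W1 : psdmx (1%:M - udiag S w).
  rewrite -(udiag1 uS) udiagN udiagD; apply: psdmx_udiag => i.
  by rewrite subr_ge0; case: (w1 i).
have W2 : psdmx (1%:M + udiag S w).
  rewrite -(udiag1 uS) udiagD; apply: psdmx_udiag => i.
  by rewrite addrC -[X in _ + X]opprK subr_ge0; case: (w1 i).
have hH := hermsymmx_udiag_real S dR.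
apply: le_trans (mxtrace_le_trnorm (hermsymmxDZ hH hB lR) W1 W2).
rewrite mulmxDr mxtraceD -scalemxAr mxtraceZ (mxtrace_mulC _ B).
have -> : \tr (B *m udiag S w) = 0.
  rewrite -cE /w -udiagD -udiagD -udiagN -udiagZ !mulmxDr !mxtraceD mulmxN.
  by rewrite -scalemxAr mxtraceZ raddfN addrA.
(* What remains is Tr(W H) = ||H||: [w i * d i = |d i|] for each [i], since [c] only enters where
   [d i = 0]. *)
rewrite mulr0 addr0 udiagM // mxtrace_udiag // trnorm_udiag //.
apply: ler_sum => i _; rewrite /w.
by case: (real_ltgt0P (dR i)) => h;
  rewrite ?mulr0 ?mulr1 ?oppr0 ?addr0 ?add0r ?mul1r ?mulN1r ?h ?mulr0.
Qed.

(** * Orthogonality implies the trace inequality for the positive eigenspace *)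

Lemma tr_pos_proj_le_of_BJ S d B : S \is unitarymx ->
    (forall i, d i \is Num.real) -> B \is hermsymmx -> psdmx B ->
    (forall l, l \is Num.real ->
      trnorm (udiag S d) <= trnorm (udiag S d + l *: B)) ->
  \tr (B *m pos_proj (udiag S d)) <= 2^-1 * \tr B.
Proof.
move=> uS dR hB B0 BJ; rewrite pos_proj_udiag //.
set P := udiag S _; set H := udiag S d in BJ *.
pose Hp := udiag S (fun i => (0 < d i)%R%:R * d i).
(* The pseudo-inverse of [Hp]: its inverse on the range of [P], zero on the complement. *)
pose G := udiag S (fun i => (0 < d i)%R%:R * (d i)^-1).
have iR i : (0 < d i)%R%:R \is @Num.real C by rewrite realn.
have PC : P^t* = P by rewrite udiag_trmxC.
have GC : G^t* = G by rewrite udiag_trmxC // => i; rewrite rpredM ?rpredV.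
have GHp : G *m Hp = P.
  rewrite udiagM //; apply: eq_udiag => i.
  by case h: (0 < d i); rewrite ?mul0r // !mul1r mulVf // gt_eqF.
have HpG : Hp *m G = P.
  by rewrite -GHp !udiagM //; apply: eq_udiag => i; rewrite mulrC.
have PG : P *m G = G.
  by rewrite udiagM //; apply: eq_udiag => i; rewrite mulrA -natrM mulnb andbb.
have G0 : psdmx G.
  apply: psdmx_udiag => i; case h: (0 < d i); rewrite ?mul0r // mul1r.
  by rewrite invr_ge0 ltW.
have Hp0 : psdmx Hp.
  by apply: psdmx_udiag => i; case h: (0 < d i); rewrite ?mul0r // mul1r ltW.
have Hm0 : psdmx (Hp - H).
  rewrite udiagN udiagD; apply: psdmx_udiag => i.
  case: (real_ltgt0P (dR i)) => h.
  - by rewrite mul1r subrr.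
  - by rewrite mul0r add0r oppr_ge0 ltW.
  - by rewrite mul0r add0r h oppr0.
have PP : P *m P = P.
  by rewrite udiagM //; apply: eq_udiag => i; rewrite -natrM mulnb andbb.
have hH : H \is hermsymmx := hermsymmx_udiag_real S dR.
(* The second trace norm bound is an equality at [X = Hp]. *)
have trHE : trnorm H = 2 * \tr Hp - \tr H.
  rewrite trnorm_udiag // !mxtrace_udiag // mulr_sumr -sumrB.
  apply: eq_bigr => i _; case: (real_ltgt0P (dR i)) => h; rewrite ?h.
  - by rewrite mul1r mulr_natl mulr2n addrK.
  - by rewrite mul0r mulr0 add0r.
  - by rewrite mulr0 mulr0 subrr.
(* Otherwise [mulmxA] reassociates inside the bodies, which are products. *)
clearbody P Hp G H.
have BC := hermsymmxP _ hB.
(* [K] is chosen so that [K^t* P + P K] is [B] minus its block off the range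
   of [P]; then [X] below is positive, by congruence, and above [H - e B]. *)
pose K := B - 2^-1 *: (B *m P).
have KC : K^t* = B - 2^-1 *: (P *m B).
  rewrite trmxCB trmxCZ BC trmxC_mul BC PC.
  by rewrite fmorphV rmorph_nat.
pose Q := 1%:M - P.
have QC : Q^t* = Q by rewrite trmxCB PC trmx1 map_mx1.
have KE : K^t* *m P + P *m K = B - Q *m B *m Q.
  rewrite KC /K /Q !mulmxBl !mulmxBr !mul1mx !mulmx1 -!scalemxAl -!scalemxAr.
  rewrite !mulmxA.
  move: (P *m B) (B *m P) (P *m B *m P) => PB BP PBP.
  by apply/matrixP=> i j; rewrite !mxE; field.
pose k := \tr (K^t* *m G *m K).
have k0 : 0 <= k by apply/psdmx_tr_ge0/psdmx_congr.
have trKE : \tr (K^t* *m P) + \tr (P *m K) = \tr (B *m P).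
  rewrite -mxtraceD KE raddfB /= -mulmxA (mxtrace_mulC Q) -mulmxA.
  have -> : Q *m Q = Q.
    by rewrite /Q mulmxBl mul1mx mulmxBr mulmx1 PP subrr subr0.
  by rewrite mulmxBr mulmx1 raddfB /= subKr.
have bound e : 0 < e -> 2 * \tr (B *m P) - \tr B <= 2 * (e * k).
  move=> e0; have eR := gtr0_real e0.
  (* As [G] inverts [Hp] on the range of [P], this congruence changes [Hp] by [- e (K^t* P + P K)]
     to first order, and the term in [e ^+ 2] is positive semidefinite. *)
  pose T := 1%:M - e *: (G *m K).
  pose X := T^t* *m Hp *m T.
  have XE : X = Hp - e *: (K^t* *m P + P *m K) + e ^+ 2 *: (K^t* *m G *m K).
    rewrite /X /T trmxCB trmxCZ trmx1 map_mx1 trmxC_mul GC.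
    rewrite (CrealP eR) mulmxBl mul1mx -scalemxAl -(mulmxA _ G Hp) GHp.
    rewrite mulmxBr mulmx1 -scalemxAr mulmxBl -scalemxAl !mulmxA HpG.
    rewrite -(mulmxA _ P G) PG.
    move: (K^t* *m P) (P *m K) (K^t* *m G *m K) => KP PK KGK.
    by apply/matrixP=> i j; rewrite !mxE; ring.
  have hHB : H + (- e) *: B \is hermsymmx.
    by rewrite hermsymmxDZ ?rpredN.
  have XA : psdmx (X - (H + (- e) *: B)).
    have -> : X - (H + (- e) *: B) =
        (Hp - H) + e *: (Q^t* *m B *m Q) + e ^+ 2 *: (K^t* *m G *m K).
      rewrite XE KE QC.
      move: (Q *m B *m Q) (K^t* *m G *m K) => QBQ KGK.
      by apply/matrixP=> i j; rewrite !mxE; ring.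
    apply: psdmxD; last first.
      by apply: psdmxZ; [rewrite exprn_ge0 // ltW | apply: psdmx_congr].
    apply: psdmxD => //.
    by apply: psdmxZ; [rewrite ltW | apply: psdmx_congr].
  have := trnorm_le_mxtrace hHB (psdmx_congr T Hp0) XA.
  rewrite -/X XE -scaleNr !(mxtraceD, mxtraceZ) trKE -/k.
  have BJe : trnorm H <= trnorm (H + (- e) *: B) by rewrite BJ ?rpredN.
  move=> /(le_trans BJe).
  (* The terms in [Hp] and [H] cancel and a factor [e] is divided out. *)
  rewrite trHE -subr_ge0 => ineq; rewrite -subr_ge0 -(pmulr_rge0 _ e0).
  by congr (0 <= _) : ineq; ring.
rewrite mulrC ler_pdivlMr ?ltr0n // mulrC -subr_le0.
set t := 2 * _ - _ in bound *.
(* Needed to negate [t <= 0] as [0 < t]. The trace of [B P] is real because it equals that of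
   [P B P]. *)
have tR : t \is Num.real.
  apply: rpredB; last exact/ger0_real/psdmx_tr_ge0.
  apply: rpredM; first exact: realn.
  have -> : \tr (B *m P) = \tr (P^t* *m B *m P).
    by rewrite PC [RHS]mxtrace_mulC mulmxA PP mxtrace_mulC.
  exact/ger0_real/psdmx_tr_ge0/psdmx_congr.
rewrite real_leNgt ?real0 //; apply/negP => t0.
have k1 : 0 < 2 * k + 1 by rewrite ltr_wpDl ?mulr_ge0.
(* With this value as [e], [2 e k = t - e < t], contradicting [bound]; the added 1 keeps the
   denominator positive when [k = 0]. *)
have e0 : 0 < t / (2 * k + 1) by rewrite divr_gt0.
have := bound _ e0.
have -> : 2 * (t / (2 * k + 1) * k) = t - t / (2 * k + 1).
  by field; rewrite gt_eqF.
by rewrite lerDl oppr_ge0 => /(lt_le_trans e0); rewrite ltxx.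
Qed.

End UnitaryDiagonal.

(** * The characterisation of orthogonality *)

Theorem theorem2 (R : realType) (n : nat) (H B : 'M[R[i]]_n)
    (hH : H \is hermsymmx) (hB : B \is hermsymmx) (hBpsd : psdmx B) :
  trnorm_BJ_orthogonal H B <->
  (\tr (B *m pos_proj H) <= 2^-1 * \tr B /\
   \tr (B *m neg_proj H) <= 2^-1 * \tr B).
Proof.
have [S [d [uS dR ->]]] := hermsymmx_udiag hH.
split=> [BJ|[hp hm] l]; last first.
  have lR : l%:C \is Num.real by apply/complex_realP; exists l.
  exact: (trnorm_le_of_tr_proj uS dR hB hBpsd hp hm lR).
have {}BJ l : l \is Num.real ->
    trnorm (udiag S d) <= trnorm (udiag S d + l *: B).
  by move=> /complex_realP[r ->]; apply: BJ.
split; first exact: (tr_pos_proj_le_of_BJ uS dR hB hBpsd BJ).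
(* Orthogonality passes from [H] to [- H] on replacing [l] by [- l], so the first half applies to
   [- H]. *)
rewrite (neg_proj_opp d uS).
have dNR i : - d i \is Num.real by rewrite rpredN.
apply: (tr_pos_proj_le_of_BJ uS dNR hB hBpsd) => l lR.
rewrite -udiagN trnormN -[_ + _]opprK trnormN opprD opprK -scaleNr.
by apply: BJ; rewrite rpredN.
Qed.
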